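(* Let $P$ and $Q$ be probability measures on a measurable space $\mathcal{X}$, let $Q = Q_a + Q_s$ be the Lebesgue decomposition of $Q$ with respect to $P$ ($Q_a \ll P$, $Q_s \perp P$), and let $U : [0,\infty] \to [-\infty,\infty]$ be measurable. Suppose that $U$ is concave, upper semicontinuous and finite on $(0,\infty)$, and assume that $$\limsup_{z\to\infty} \frac{U(z)}{z} \le 0.$$ Then, for every $\lambda>0$, the pointwise problem $$\operatorname*{arg\,max}_{z \in [0,\infty)} \left\{\frac{dQ_a}{dP}(x)\, U(z) - \lambda z\right\}$$ has a non-empty compact interval of maximizers. Its smallest maximizer $\varepsilon_\lambda(x)$ defines a measurable $\varepsilon_\lambda$ and is non-increasing in $\lambda$. If $\mathrm{E}^P[\varepsilon_\lambda]<\infty$ for every $\lambda>0$, then there exists a pair $(\lambda^*,\varepsilon^* )$, with $\lambda^*\in[0,\infty)$ and $\varepsilon^*$ a valid e-value for $H=\{P\}$, such that $$\varepsilon^*(x) \in \operatorname*{arg\,max}_{z \in [0,\infty)} \left\{\frac{dQ_a}{dP}(x)\, U(z) - \lambda^* z\right\}, \quad P\text{-a.s.},$$ $\lambda^*(1-\mathrm{E}^P[\varepsilon^*])=0$, and $U(\varepsilon^* )$ is finite $Q_a$-almost surely; consequently a $U$-optimal e-value exists.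
   Context: Notation: $\mathrm{E}^\mu[f]=\int f\,d\mu$ for any nonnegative measure $\mu$; $dQ_a/dP$ is a $[0,\infty)$-valued version of the Radon--Nikodym derivative; convention $0\times U(z)=0$. Concavity and upper semicontinuity of $U$ are understood on $[0,\infty)$ (valid e-values are finite $P$-a.s., hence $Q_a$-a.s., so $U(\infty)$ is immaterial); ''finite on $(0,\infty)$'' allows $U(0)=-\infty$. An e-value is a measurable map $\varepsilon:\mathcal{X}\to[0,\infty]$; it is valid for the simple hypothesis $H=\{P\}$ if $\mathrm{E}^P[\varepsilon]\le 1$. A valid e-value $\varepsilon^*$ is $U$-optimal (against $Q_a$) if, for every valid e-value $\varepsilon$, $\mathrm{E}^{Q_a}[U(\varepsilon^* )-U(\varepsilon)]$ is well-defined and $\geq 0$. Here ''well-defined'' means that the integrand avoids an ambiguous $\infty-\infty$ $Q_a$-almost surely, and that its positive part or its negative part has finite $Q_a$-expectation. *)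

(* Defs.v *)
From mathcomp Require Export all_boot all_order all_algebra.
From mathcomp Require Export all_classical all_reals all_analysis.
From mathcomp Require Export measurable_realfun.
Export Order.TTheory GRing.Theory Num.Theory.
Export numFieldNormedType.Exports.

#[export] Set Implicit Arguments.
#[export] Unset Strict Implicit.
#[export] Unset Printing Implicit Defensive.

Local Open Scope classical_set_scope.
Local Open Scope ring_scope.
Local Open Scope ereal_scope.

Definition mutually_singular d (X : measurableType d) (R : realType)
    (mu nu : {measure set X -> \bar R}) : Prop :=
  exists A : set X, [/\ measurable A, nu A = 0 & mu (~` A) = 0].

Definition lebesgue_decomposition d (X : measurableType d) (R : realType)
    (Q P Qa Qs : {measure set X -> \bar R}) : Prop :=
  [/\ forall A, measurable A -> Q A = Qa A + Qs A,
      Qa `<< P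
    & mutually_singular Qs P].

(* [Radon_Nikodym] of the library is one fixed version, which may be negative
   on a null set; here any [0, +oo[-valued version is allowed. *)
Definition Radon_Nikodym_version d (X : measurableType d) (R : realType)
    (nu mu : {measure set X -> \bar R}) (f : X -> R) : Prop :=
  [/\ measurable_fun setT f,
      forall x, (0 <= f x)%R
    & forall A, measurable A -> nu A = \int[mu]_(x in A) (f x)%:E].

(* The value -oo is allowed. Since 0 * -oo = 0 and -oo + y = -oo in \bar R,
   the inequality has its usual meaning when f < +oo; a value +oo at the
   boundary point of `[0, +oo[ is excluded by it as soon as f is finite
   on `]0, +oo[. *)
Definition concave_on (R : realType) (D : set R) (f : R -> \bar R) : Prop :=
  forall x y t : R, D x -> D y -> (0 <= t <= 1)%R ->
    t%:E * f x + (1 - t)%:E * f y <= f (t * x + (1 - t) * y)%R.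

Definition upper_semicontinuous_on (R : realType) (D : set R)
    (f : R -> \bar R) : Prop :=
  lower_semicontinuous (fun z : subspace D => - f z).

Definition argmax (T : Type) (R : realType) (D : set T) (h : T -> \bar R) :
    set T :=
  [set z | D z /\ forall y, D y -> h y <= h z].

(* 0 * U z = 0 for every value of U z, by the convention of \bar R. *)
Definition pointwise_objective (R : realType) (U : \bar R -> \bar R)
    (r lam : R) (z : R) : \bar R :=
  r%:E * U z%:E - (lam * z)%:E.

Definition pointwise_argmax (R : realType) (U : \bar R -> \bar R)
    (r lam : R) : set R :=
  argmax `[0%R, +oo[ (pointwise_objective U r lam).

(* The infimum is meant to be a minimum: this is only the smallest maximizer
   when it belongs to [pointwise_argmax U r lam]. *)
Definition smallest_maximizer (R : realType) (U : \bar R -> \bar R)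
    (r lam : R) : R :=
  inf (pointwise_argmax U r lam).

Definition evalue d (X : measurableType d) (R : realType)
    (e : X -> \bar R) : Prop :=
  measurable_fun setT e /\ forall x, 0 <= e x.

Definition valid_evalue d (X : measurableType d) (R : realType)
    (P : {measure set X -> \bar R}) (e : X -> \bar R) : Prop :=
  evalue e /\ \int[P]_x e x <= 1.

(* [a +? b] says that a + b is not of the form +oo - oo or -oo + oo. *)
Definition expected_difference_well_defined d (X : measurableType d)
    (R : realType) (mu : {measure set X -> \bar R}) (g h : X -> \bar R) :
    Prop :=
  {ae mu, forall x, g x +? - h x} /\
  (\int[mu]_x (g \- h)^\+ x < +oo \/ \int[mu]_x (g \- h)^\- x < +oo).

Definition U_optimal d (X : measurableType d) (R : realType)
    (P Qa : {measure set X -> \bar R}) (U : \bar R -> \bar R)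
    (estar : X -> \bar R) : Prop :=
  valid_evalue P estar /\
  forall e : X -> \bar R, valid_evalue P e ->
    expected_difference_well_defined Qa (U \o estar) (U \o e) /\
    0 <= \int[Qa]_x (U (estar x) - U (e x)).

(* Main.v *)
Require Import Defs.
From mathcomp Require Import ring lra.

(** The e-value is found by Lagrangian duality for the single constraint
    E^P[e] <= 1, and every step is one-dimensional in the multiplier lam.

    Pointwise, with r = dQa/dP(x), the objective z |-> r U(z) - lam z is concave
    and upper semicontinuous, and sublinearity of U at infinity makes the linear
    penalty win outside a bounded interval; hence its maximizers form a nonempty
    compact interval. The smallest one is nondecreasing in r and nonincreasing in
    lam ([smallest_maximizer_mono]): this gives both the monotonicity in lam and,
    monotone functions being Borel, the measurability in x.

    Let g(lam) = E^P[e_lam], where e_lam is the smallest maximizer. It is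
    nonincreasing and tends to 0 at infinity, so lam* = inf {lam > 0 | g <= 1}
    exists in [0, +oo[. Limits of maximizers along converging multipliers are
    maximizers for the limit multiplier ([argmax_closed_graph]). Letting lam
    decrease to lam*, monotone convergence yields a maximizer L with
    E^P[L] <= 1 ([exists_right_limit]); when lam* > 0, letting lam increase to
    lam*, dominated convergence yields a maximizer h with E^P[h] >= 1
    ([exists_left_limit]). If lam* = 0, take e = L. Otherwise a convex
    combination of L and h has expectation exactly 1, and it is still a maximizer
    because the maximizers form an interval ([exists_multiplier]).

    Optimality of the e-value e so obtained is weak duality ([argmax_optimal]).
    For a valid e-value e', the inequality f U(e') - lam* e' <= f U(e) - lam* e
    holds P-a.s. Let D = U(e) - U(e'). Separating positive and negative parts,
    f D^- + lam* e <= f D^+ + lam* e' has only nonnegative terms, so that it can be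
    integrated without any integrability assumption on U. Complementary slackness
    turns lam* E^P[e] into lam*, which dominates lam* E^P[e'], and
    E^Qa[D^-] <= E^Qa[D^+] follows. Finiteness of E^Qa[D^-] comes from
    f D^- <= lam* e'. *)

Local Open Scope classical_set_scope.
Local Open Scope ring_scope.
Local Open Scope ereal_scope.

(** * Integration against a density *)

Lemma ae_null_dominates d (X : measurableType d) (R : realType)
    (nu mu : {measure set X -> \bar R}) (A : X -> Prop) :
  nu `<< mu -> {ae mu, forall x, A x} -> {ae nu, forall x, A x}.
Proof.
move=> /null_content_dominatesP numu [N [mN N0 AN]]; exists N.
by split=> //; exact: numu.
Qed.

Section density.
Context d (X : measurableType d) (R : realType).
Context (mu : {sigma_finite_measure set X -> \bar R})
  (nu : {measure set X -> \bar R}) (f : X -> R).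
Hypothesis nu_f : Radon_Nikodym_version nu mu f.
Hypothesis nu_fin : nu setT < +oo.

Let mf : measurable_fun setT (EFin \o f).
Proof. by case: nu_f => mf _ _; exact/measurable_EFinP. Qed.

Lemma density_dominates : nu `<< mu.
Proof.
apply/null_content_dominatesP => A mA A0; case: nu_f => _ _ ->//.
by rewrite null_set_integral//; exact: measurable_funTS.
Qed.

(** The set where f vanishes carries no nu-mass. *)
Lemma density_gt0 : {ae nu, forall x, (0 < f x)%R}.
Proof.
case: (nu_f) => mf' f0 nuE; pose N := f @^-1` [set 0%R].
have mN : measurable N by rewrite -[N]setTI; exact: mf'.
exists N; split=> //; last first.
  by move=> x /= /negP; rewrite -leNgt => fx; apply/eqP; rewrite eq_le fx f0.
by rewrite nuE// integral0_eq// => x ->.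
Qed.

(** By uniqueness, f agrees almost everywhere with the Radon-Nikodym derivative for
    which the change of variables is known. That derivative is attached to a
    finite measure; restricting nu to the whole space presents it as one. *)
Lemma integral_density (h : X -> \bar R) :
  measurable_fun setT h -> (forall x, 0 <= h x) ->
  \int[nu]_x h x = \int[mu]_x (h x * (f x)%:E).
Proof.
move=> mh h0; case: (nu_f) => _ f0 nuE.
pose nu' : {finite_measure set X -> \bar R} := mfrestr measurableT nu_fin.
have nu'E A : nu' A = nu A by rewrite /nu'/= /mfrestr/= /mrestr setIT.
have nu'mu : nu' `<< mu by rewrite (_ : (nu' : set X -> \bar R) = nu);
  [exact: density_dominates|exact/funext].
have fE : ae_eq mu setT (Radon_Nikodym_SigmaFinite.f nu' mu) (EFin \o f).
  apply: integral_ae_eq => //; first exact: Radon_Nikodym_SigmaFinite.f_integrable.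
  by move=> E _ mE; rewrite -Radon_Nikodym_SigmaFinite.f_integral// nu'E nuE.
rewrite (eq_measure_integral nu') => [|A _ _]; last exact/esym/nu'E.
rewrite -(Radon_Nikodym_SigmaFinite.change_of_variables nu'mu)//.
have mg := measurable_int _ (Radon_Nikodym_SigmaFinite.f_integrable nu'mu).
apply: ae_eq_integral => //; [exact: emeasurable_funM|exact: emeasurable_funM|].
exact: ae_eqe_mul2l.
Qed.

End density.

(** * The pointwise problem *)

Section utility.
Context (R : realType) (U : \bar R -> \bar R).
Hypothesis U_concave : concave_on `[0%R, +oo[ (fun z : R => U z%:E).
Hypothesis U_usc : upper_semicontinuous_on `[0%R, +oo[ (fun z : R => U z%:E).
Hypothesis U_fin : forall z : R, (0 < z)%R -> U z%:E \is a fin_num.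
Hypothesis U_limsup :
  limf_esup (fun z : R => U z%:E * (z^-1)%:E) (pinfty_nbhs R) <= 0.
Implicit Types r lam z p : R.

Local Notation obj := (pointwise_objective U).
Local Notation amax := (pointwise_argmax U).
Local Notation smin := (smallest_maximizer U).

Lemma utility_real z : (0 < z)%R -> exists v : R, U z%:E = v%:E.
Proof. by move=> /U_fin zf; exists (fine (U z%:E)); rewrite fineK. Qed.

(** At 0 a value +oo would, by concavity, propagate to 1/2. *)
Lemma utility_lt_pinfty z : (0 <= z)%R -> U z%:E < +oo.
Proof.
rewrite le_eqVlt => /predU1P[<-|/U_fin]; last by rewrite fin_numElt => /andP[].
rewrite ltey; apply/eqP => U0.
have [v v1] := utility_real (@ltr01 R).
have [w w1] : exists w : R, U (2^-1 : R)%:E = w%:E.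
  by apply: utility_real; rewrite invr_gt0.
have h01 : (0 <= (2^-1 : R) <= 1)%R by rewrite invr_ge0 ler0n/= invf_le1// ler1n.
have D0 : `[0%R, +oo[%classic (0 : R)%R by rewrite /= in_itv/= lexx.
have D1 : `[0%R, +oo[%classic (1 : R)%R by rewrite /= in_itv/= ler01.
have := U_concave D0 D1 h01.
rewrite mulr0 add0r mulr1 U0 v1 gt0_muley ?lte_fin ?invr_gt0//.
have -> : (1 - 2^-1 = 2^-1 :> R)%R by lra.
by rewrite -EFinM addye// w1.
Qed.

Lemma utility_sublinear (e : R) : (0 < e)%R ->
  exists2 M : R, (0 < M)%R & forall z, (M < z)%R -> U z%:E <= (e * z)%:E.
Proof.
move=> e0.
have : limf_esup (fun z : R => U z%:E * (z^-1)%:E) (pinfty_nbhs R) < e%:E.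
  by rewrite (le_lt_trans U_limsup).
rewrite limf_esupE => /ereal_inf_lt[_ [A [M [Mr MA]] <-]] Ae.
exists (Num.max M 1%R); first by rewrite lt_max ltr01 orbT.
move=> z; rewrite gt_max => /andP[Mz z1].
have z0 : (0 < z)%R by rewrite (lt_trans _ z1).
have : U z%:E * (z^-1)%:E <= e%:E.
  by apply/ltW/(le_lt_trans _ Ae)/ereal_sup_ubound; exists z => //; exact: MA.
by have [v ->] := utility_real z0; rewrite -EFinM !lee_fin ler_pdivrMr.
Qed.

Lemma objective_real r lam z (v : R) : U z%:E = v%:E ->
  obj r lam z = (r * v - lam * z)%:E.
Proof. by rewrite /pointwise_objective => ->; rewrite -EFinM. Qed.

Lemma objective0 lam z : obj 0 lam z = (- (lam * z))%:E.
Proof. by rewrite /pointwise_objective mul0e add0e. Qed.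

(** Dividing by r > 0 is legitimate even where U z = -oo; this transfers upper
    semicontinuity from U to the objective. *)
Lemma objective_lt r lam z (a : R) : (0 < r)%R -> (0 <= z)%R ->
  (obj r lam z < a%:E) = (U z%:E < ((a + lam * z) / r)%:E).
Proof.
move=> r0 /utility_lt_pinfty; rewrite /pointwise_objective.
case: (U z%:E) => [v _|//|_]; last by rewrite gt0_muleNy// addNye !ltNyr.
by rewrite -EFinM !lte_fin ltr_pdivlMr// mulrC ltrBlDr.
Qed.

(** For r = 0 the objective is linear, whatever U is. For r > 0, a real number c
    strictly between U p and the threshold for U p in [objective_lt] separates the
    upper semicontinuity of U from the continuity of that threshold. *)
Lemma objective_usc r lam p (a : R) : (0 <= r)%R -> (0 <= p)%R ->
  obj r lam p < a%:E ->
  \forall z \near p, (0 <= z)%R -> obj r lam z < a%:E.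
Proof.
move=> + p0; rewrite le_eqVlt => /predU1P[<-|r0].
  rewrite objective0 lte_fin => pa; near=> z => _.
  rewrite objective0 lte_fin ltrNl.
  near: z; apply: (cvgr_gt (lam * p)%R); last by rewrite ltrNl.
  by apply: cvgM; [exact: cvg_cst|exact: cvg_id].
rewrite objective_lt// => Upa.
have [c Upc ca] : exists2 c : R, U p%:E < c%:E & (c < (a + lam * p) / r)%R.
  move: Upa (utility_lt_pinfty p0); case: (U p%:E) => [v|//|] vc _.
    rewrite lte_fin in vc; exists ((v + (a + lam * p) / r) / 2)%R.
      by rewrite lte_fin midf_lt.
    by rewrite midf_lt.
  by exists ((a + lam * p) / r - 1)%R; [exact: ltNyr|rewrite ltrBlDr ltrDl].
have Dp : `[0%R, +oo[%classic p by rewrite /= in_itv/= p0.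
have [|V + Vc] := U_usc (x := p) (a := (- c)%R); first by rewrite EFinN lteN2.
rewrite /nbhs/= -nbhs_subspace_in// => pV.
have cz : \forall z \near p, (c < (a + lam * z) / r)%R.
  have cp : ((a + lam * z) / r)%R @[z --> p] --> ((a + lam * p) / r)%R.
    apply: cvgM; last exact: cvg_cst.
    by apply: cvgD; [exact: cvg_cst|apply: cvgM; [exact: cvg_cst|exact: cvg_id]].
  exact: (cvgr_gt _ cp).
rewrite /within in pV; near=> z => z0.
rewrite objective_lt// (@lt_trans _ _ c%:E)//; last by rewrite lte_fin; near: z.
have zV : `[0%R, +oo[%classic z -> V z by near: z.
by rewrite -lteN2 -EFinN; apply: Vc; apply: zV; rewrite /= in_itv/= z0.
Unshelve. all: by end_near. Qed.

(** For r > 0 and large z, U z <= lam / (2 r) z: half of the penalty lam z is left. *)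
Lemma objective_tail r lam : (0 <= r)%R -> (0 < lam)%R ->
  exists2 M : R, (1 <= M)%R & forall z, (M < z)%R -> obj r lam z < obj r lam 1.
Proof.
move=> + lam0; rewrite le_eqVlt => /predU1P[<-|r0].
  by exists 1%R => // z z1; rewrite !objective0 lte_fin ltrN2 ltr_pM2l.
have [|M0 M00 UM] := utility_sublinear (e := (lam / (2 * r))%R).
  by rewrite divr_gt0// mulr_gt0.
have [u u1] := utility_real (@ltr01 R).
pose M1 := (2 * (lam - r * u) / lam)%R.
exists (Num.max M0 (Num.max 1 M1)%R); first by rewrite !le_max lexx orbT.
move=> z; rewrite !gt_max => /and3P[/UM zM z1 M1z].
have z0 : (0 < z)%R by rewrite (lt_trans _ z1).
rewrite (objective_real _ _ u1); rewrite objective_lt// ?ltW//.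
rewrite (le_lt_trans zM)// lte_fin mulr1.
have -> : (lam / (2 * r) * z = (lam * z / 2) / r)%R by field; rewrite gt_eqF.
rewrite ltr_pM2r ?invr_gt0//.
by move: M1z; rewrite /M1 ltr_pdivrMr//; lra.
Qed.


Lemma argmax_ge0 r lam z : amax r lam z -> (0 <= z)%R.
Proof. by case; rewrite /= in_itv/= andbT. Qed.

Lemma argmaxP r lam z : amax r lam z <->
  (0 <= z)%R /\ forall y, (0 <= y)%R -> obj r lam y <= obj r lam z.
Proof.
split=> -[z0 zmax]; split.
- by move: z0; rewrite /= in_itv/= andbT.
- by move=> y y0; apply: zmax; rewrite /= in_itv/= y0.
- by rewrite /= in_itv/= z0.
- by move=> y; rewrite /= in_itv/= andbT => y0; exact: zmax.
Qed.


(** Upper semicontinuity bounds the objective at v t from above near z; if some y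
    beat z at the multiplier lam, then by continuity in the multiplier it would
    beat v t at the multiplier u t. For a constant u this says that the set of
    maximizers is closed. *)
Lemma argmax_closed_graph (T : Type) (F : set_system T) (FF : ProperFilter F)
    (u v : T -> R) r lam z :
  (0 <= r)%R -> u @ F --> lam -> v @ F --> z ->
  (\forall t \near F, amax r (u t) (v t)) -> amax r lam z.
Proof.
move=> r0 ulam vz uv.
have z0 : (0 <= z)%R.
  apply: (@closed_cvg _ _ F FF v (fun x => 0 <= x)%R _ _ z vz).
    exact: closed_ge.
  by apply: filterS uv => t /argmax_ge0.
apply/argmaxP; split=> // y y0; rewrite leNgt; apply/negP => zy.
have [w yw] : exists w : R, obj r lam y = w%:E.
  move: zy (utility_lt_pinfty y0); rewrite /pointwise_objective.
  case: (U y%:E) => [w _ _|//|]; first by exists (r * w - lam * y)%R.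
  move: r0; rewrite le_eqVlt => /predU1P[<- _ _|r0].
    by rewrite mul0e add0e; eexists; rewrite -EFinN.
  by rewrite gt0_muleNy// addNye ltNge leNye.
(* Comparing two multipliers only costs a linear term. *)
have objD s x : obj r s x = obj r lam x + ((lam - s) * x)%:E.
  rewrite /pointwise_objective -addeA -EFinN -EFinD; congr (_ + _%:E).
  by ring.
have [a za aw] : exists2 a : R, obj r lam z < a%:E & (a < w)%R.
  move: zy; rewrite yw; case: (obj r lam z) => [b|//|_].
    by rewrite lte_fin => bw; exists ((b + w) / 2)%R; rewrite ?lte_fin midf_lt.
  by exists (w - 1)%R; [exact: ltNyr|rewrite ltrBlDr ltrDl].
have va : \forall t \near F, (0 <= v t)%R -> obj r lam (v t) < a%:E.
  by move: (objective_usc r0 z0 za); exact: vz.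
have gap : (a + (lam - u t) * (v t - y))%R @[t --> F] --> a.
  rewrite -[X in _ --> X]addr0 -(mul0r (z - y)%R) -(subrr lam).
  by apply: cvgD; [exact: cvg_cst|apply: cvgM; apply: cvgB => //; exact: cvg_cst].
suff /(cvgr_to_ge gap) : \forall t \near F, (w <= a + (lam - u t) * (v t - y))%R.
  by rewrite leNgt aw.
near=> t.
have /argmaxP[vt0 vtmax] : amax r (u t) (v t) by near: t.
have /(_ vt0) : (0 <= v t)%R -> obj r lam (v t) < a%:E by near: t.
have := vtmax _ y0; rewrite !(objD (u t)) yw.
case: (obj r lam (v t)) => [c|//|//].
by rewrite -!EFinD lee_fin lte_fin; lra.
Unshelve. all: by end_near. Qed.

Lemma argmax_closed r lam : (0 <= r)%R -> closed (amax r lam).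
Proof.
move=> r0 p pcl; pose F := within (amax r lam) (nbhs p).
have FF : ProperFilter F by exact: within_nbhs_proper.
apply: (@argmax_closed_graph _ F FF (cst lam) id r lam p r0).
- exact: cvg_cst.
- exact: cvg_within.
- exact: withinT.
Qed.

Lemma argmax_bounded r lam : (0 <= r)%R -> (0 < lam)%R ->
  exists M : R, amax r lam `<=` `[0%R, M].
Proof.
move=> r0 lam0; have [M M1 Mtail] := objective_tail r0 lam0.
exists M => z /argmaxP[z0 zmax]; rewrite /= in_itv/= z0 leNgt/=.
apply/negP => /Mtail; apply/negP; rewrite -leNgt; exact: zmax.
Qed.

Lemma argmax_compact r lam : (0 <= r)%R -> (0 < lam)%R ->
  compact (amax r lam).
Proof.
move=> r0 lam0; have [M AM] := argmax_bounded r0 lam0.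
by apply: subclosed_compact AM; [exact: argmax_closed|exact: segment_compact].
Qed.

(** On a segment containing all candidates, the superlevel sets for the levels
    c < s, with s the supremum, generate a proper filter; by compactness it has a
    cluster point, where upper semicontinuity forces the value s. *)
Lemma argmax_nonempty r lam : (0 <= r)%R -> (0 < lam)%R ->
  amax r lam !=set0.
Proof.
move=> r0 lam0; have [M M1 Mtail] := objective_tail r0 lam0.
pose K := `[0%R, M]%classic.
have K1 : K 1%R by rewrite /K/= in_itv/= ler01.
suff [p [Kp pmax]] : exists p, K p /\ forall y, K y -> obj r lam y <= obj r lam p.
  exists p; move: (Kp); rewrite /K/= in_itv/= => /andP[p0 _].
  apply/argmaxP; split=> // y y0; have [yM|My] := leP y M.
    by apply: pmax; rewrite /K/= in_itv/= y0.
  by rewrite (le_trans (ltW (Mtail _ My)))// pmax.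
set s := ereal_sup (obj r lam @` K).
have ub y : K y -> obj r lam y <= s.
  by move=> Ky; apply: ereal_sup_ubound; exists y.
have [[p Kp ps]|noS] := pselect (exists2 p, K p & obj r lam p = s).
  by exists p; split=> // y; rewrite ps; exact: ub.
have {}ub y : K y -> obj r lam y < s.
  move=> Ky; rewrite lt_neqAle ub// andbT; apply/eqP => ys.
  by apply: noS; exists y.
pose F := filter_from [set c | c < s] (fun c => [set z | K z /\ c < obj r lam z]).
have FF : ProperFilter F.
  apply: filter_from_proper; last first.
    by move=> c /= /ereal_sup_gt[_ [z Kz <-] cz]; exists z.
  apply: filter_from_filter; first by exists (obj r lam 1%R); exact: ub.
  move=> c1 c2 /= c1s c2s; exists (Order.max c1 c2).
    by rewrite /= gt_max c1s.
  by move=> z /=; rewrite gt_max => -[Kz /andP[]].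
have FK : F K by exists (obj r lam 1%R) => /=; [exact: ub|move=> z /= []].
have [p [Kp Fp]] := segment_compact FF FK.
exfalso; have := ub _ Kp => /ereal_sup_gt[_ [y Ky <-] py].
have p0 : (0 <= p)%R by move: Kp; rewrite /K/= in_itv/= => /andP[].
have y0 : (0 <= y)%R by move: Ky; rewrite /K/= in_itv/= => /andP[].
have [a ya] : exists a : R, obj r lam y = a%:E.
  exists (fine (obj r lam y)); rewrite fineK// fin_numElt.
  by rewrite (le_lt_trans (leNye _) py) (lt_le_trans (ub _ Ky) (leey _)).
rewrite ya in py.
have Fa : F [set z | K z /\ a%:E < obj r lam z] 
  by exists a%:E => //=; rewrite -ya; exact: ub.
have [z [[Kz az] /=]] := Fp _ _ Fa (objective_usc r0 p0 py).
move: Kz; rewrite /K/= in_itv/= => /andP[z0 _] /(_ z0).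
by rewrite ltNge (ltW az).
Qed.

Lemma argmax_real r lam z : (0 < r)%R -> amax r lam z ->
  exists v : R, U z%:E = v%:E.
Proof.
move=> r0 /argmaxP[z0 zmax]; have [u u1] := utility_real (@ltr01 R).
move: (zmax _ ler01) (utility_lt_pinfty z0); rewrite (objective_real _ _ u1).
rewrite /pointwise_objective; case: (U z%:E) => [v _ _|//|]; first by exists v.
by rewrite gt0_muleNy// addNye leeNy_eq.
Qed.

(** A concave function is at least its maximum between two of its maximizers. *)
Lemma argmax_interval r lam : (0 <= r)%R -> (0 <= lam)%R ->
  is_interval (amax r lam).
Proof.
move=> r0 lam0 x y Ax Ay z /andP[xz zy].
have [x0 xmax] := (argmaxP _ _ _).1 Ax; have [y0 ymax] := (argmaxP _ _ _).1 Ay.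
have z0 := le_trans x0 xz.
move: r0; rewrite le_eqVlt => /predU1P[r0|r0].
  apply/argmaxP; split=> // w w0; move: (xmax _ w0) (ymax _ w0).
  by rewrite -r0 !objective0 !lee_fin !lerN2; nra.
move: zy; rewrite le_eqVlt => /predU1P[->//|zy].
have [vx Ux] := argmax_real r0 Ax; have [vy Uy] := argmax_real r0 Ay.
have yx : (0 < y - x)%R by lra.
pose t := ((y - z) / (y - x))%R.
have t01 : (0 <= t <= 1)%R.
  by rewrite /t divr_ge0 ?ler_pdivrMr//; lra.
have zE : (z = t * x + (1 - t) * y)%R by rewrite /t; field; rewrite gt_eqF.
have Dx : `[0%R, +oo[%classic x by rewrite /= in_itv/= x0.
have Dy : `[0%R, +oo[%classic y by rewrite /= in_itv/= y0.
have := U_concave Dx Dy t01; rewrite -zE Ux Uy.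
move: (utility_lt_pinfty z0); case Uz: (U z%:E) => [vz|//|//] _.
rewrite -!EFinM -EFinD lee_fin => vz_ge.
apply/argmaxP; split=> // w w0; rewrite (le_trans (xmax _ w0))//.
move: (xmax _ y0) (ymax _ x0).
rewrite (objective_real _ _ Ux) (objective_real _ _ Uy) (objective_real _ _ Uz).
rewrite !lee_fin => yx_le xy_le.
have {}vz_ge : (r * (t * vx + (1 - t) * vy) <= r * vz)%R by rewrite ler_pM2l.
have -> : (r * vx - lam * x = t * (r * vx - lam * x) +
    (1 - t) * (r * vy - lam * y))%R.
  by rewrite (le_anti (introT andP (conj yx_le xy_le))); ring.
rewrite (le_trans _ (lerB vz_ge (lexx (lam * z)%R)))// zE.
by rewrite le_eqVlt; apply/orP; left; apply/eqP; ring.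
Qed.

Lemma smallest_maximizer_argmax r lam : (0 <= r)%R -> (0 < lam)%R ->
  amax r lam (smin r lam).
Proof.
move=> r0 lam0; have A0 := argmax_nonempty r0 lam0.
apply: (itv_closed_infimums A0 (argmax_closed r0)).
split=> [|y Ay]; last exact: lb_le_inf.
by move=> z Az; apply: ge_inf => //; exists 0%R => y /argmax_ge0.
Qed.

Lemma smallest_maximizer_lbound r lam : lbound (amax r lam) (smin r lam).
Proof. by move=> z Az; apply: ge_inf => //; exists 0%R => y /argmax_ge0. Qed.

Lemma smallest_maximizer_ge0 r lam : (0 <= smin r lam)%R.
Proof.
have [A0|A0] := pselect (amax r lam !=set0).
  by apply: lb_le_inf => // z /argmax_ge0.
by rewrite /smallest_maximizer (_ : amax r lam = set0) ?inf0//; exact/nonemptyPn.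
Qed.

(** Suppose b < a; then a > 0, so r1 > 0. Strict optimality of a over b
    (a is the smallest maximizer) and optimality of b over a force the slope
    (U a - U b) / (a - b) to be greater than lam1 / r1 and at most lam2 / r2,
    although lam2 / r2 <= lam1 / r1. *)
Lemma smallest_maximizer_mono r1 r2 lam1 lam2 : (0 <= r1)%R -> (r1 <= r2)%R ->
  (0 < lam2)%R -> (lam2 <= lam1)%R -> (smin r1 lam1 <= smin r2 lam2)%R.
Proof.
move=> r10 r12 lam20 lam21; rewrite leNgt; apply/negP => ba.
have lam10 := lt_le_trans lam20 lam21; have r20 := le_trans r10 r12.
set a := smin r1 lam1 in ba; set b := smin r2 lam2 in ba.
have Aa : amax r1 lam1 a by exact: smallest_maximizer_argmax.
have Ab : amax r2 lam2 b by exact: smallest_maximizer_argmax.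
have [a0 amx] := (argmaxP _ _ _).1 Aa; have [b0 bmx] := (argmaxP _ _ _).1 Ab.
have {}r10 : (0 < r1)%R.
  rewrite lt_neqAle r10 andbT; apply/eqP => r1E.
  by have := amx _ (lexx 0%R); rewrite -r1E !objective0 lee_fin; nra.
have {}r20 := lt_le_trans r10 r12.
have [va Ua] := argmax_real r10 Aa; have [vb Ub] := argmax_real r20 Ab.
have : obj r1 lam1 b < obj r1 lam1 a.
  rewrite ltNge; apply/negP => ab.
  have : amax r1 lam1 b by apply/argmaxP; split=> // y y0;
    exact: le_trans (amx _ y0) ab.
  by move=> /smallest_maximizer_lbound; rewrite leNgt ba.
have := bmx _ a0.
rewrite !(objective_real _ _ Ua) !(objective_real _ _ Ub).
rewrite lee_fin lte_fin => h2 h1.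
have k1 : (r2 * (lam1 * (a - b)) < r2 * (r1 * (va - vb)))%R.
  by rewrite ltr_pM2l//; lra.
have k2 : (r1 * (r2 * (va - vb)) <= r1 * (lam2 * (a - b)))%R.
  by rewrite ler_pM2l//; lra.
have k3 : (r1 * (lam2 * (a - b)) <= r2 * (lam1 * (a - b)))%R.
  by rewrite !mulrA ler_pM2r ?subr_gt0// ler_pM// ltW.
by move: k1; rewrite ltNge (le_trans _ k3)// mulrCA.
Qed.

(** For r = 0 the maximizer is 0. For r > 0, a maximizer z > e would give U a
    slope at least lam / r on [e, z], whereas concavity bounds that slope by the
    one on [e / 2, e], a constant. *)
Lemma smallest_maximizer_cvg0 r : (0 <= r)%R ->
  smin r lam @[lam --> +oo%R] --> (0 : R)%R.
Proof.
move=> r0; apply/cvgrPdist_le => e e0.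
have h0 : (0 < e / 2)%R by rewrite divr_gt0.
have [ve Ue] := utility_real e0; have [vh Uh] := utility_real h0.
pose p := Num.max 0%R (r * (ve - vh) / (e / 2))%R.
near=> lam; have : (p < lam)%R 
  by near: lam; apply: nbhs_pinfty_gt; exact: num_real.
rewrite gt_max => /andP[lam0].
rewrite sub0r normrN ger0_norm ?smallest_maximizer_ge0//.
apply: contraTT; rewrite -!ltNge => ez; rewrite -leNgt ler_pdivlMr//.
have := smallest_maximizer_argmax r0 lam0; set z := smin r lam in ez *.
move=> Az; have [z0 zmax] := (argmaxP _ _ _).1 Az.
move: r0; rewrite le_eqVlt => /predU1P[r0|{}r0].
  by have := zmax _ (lexx 0%R); rewrite -r0 !objective0 lee_fin; nra.
have [vz Uz] := argmax_real r0 Az.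
have := zmax _ (ltW e0).
rewrite (objective_real _ _ Ue) (objective_real _ _ Uz) lee_fin => opt.
have zh : (0 < z - e / 2)%R by lra.
pose t := ((z - e) / (z - e / 2))%R.
have t01 : (0 <= t <= 1)%R by rewrite /t divr_ge0 ?ler_pdivrMr//; lra.
have Dh : `[0%R, +oo[%classic (e / 2)%R by rewrite /= in_itv/= ltW.
have Dz : `[0%R, +oo[%classic z by rewrite /= in_itv/= z0.
have := U_concave Dh Dz t01.
have -> : (t * (e / 2) + (1 - t) * z = e)%R.
  by rewrite /t; field; rewrite gt_eqF//; lra.
rewrite Uh Uz Ue -!EFinM -EFinD lee_fin => conc.
have {conc} : ((z - e / 2) * (t * vh + (1 - t) * vz) <= (z - e / 2) * ve)%R.
  by rewrite ler_pM2l.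
have -> : ((z - e / 2) * (t * vh + (1 - t) * vz) = (z - e) * vh + e / 2 * vz)%R.
  by rewrite /t; field; rewrite gt_eqF//; lra.
move=> conc.
have k1 : (r * (e / 2 * (vz - ve)) <= r * ((z - e) * (ve - vh)))%R.
  by rewrite ler_pM2l//; lra.
have k2 : (e / 2 * (lam * (z - e)) <= e / 2 * (r * (vz - ve)))%R.
  by rewrite ler_pM2l//; lra.
rewrite -(ler_pM2l (_ : 0 < z - e)%R) ?subr_gt0//; move: k1 k2; lra.
Unshelve. all: by end_near. Qed.

(** * The multiplier *)

Section evalues.
Context d (X : measurableType d) (P : probability X R) (f : X -> R).
Hypothesis f_meas : measurable_fun setT f.
Hypothesis f_ge0 : forall x, (0 <= f x)%R.

Local Notation eps lam x := (smin (f x) lam).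

(** The monotone function is defined on the whole line by truncating at 0. *)
Lemma measurable_smallest_maximizer lam : (0 < lam)%R ->
  measurable_fun setT (fun x => eps lam x).
Proof.
move=> lam0; rewrite (_ : (fun x => eps lam x) =
    (fun r => smin (Num.max r 0%R) lam) \o f); last first.
  by apply/funext => x /=; rewrite max_l.
apply: measurableT_comp => //; apply: nondecreasing_measurable => // r1 r2 r12.
apply: smallest_maximizer_mono => //; first by rewrite le_max lexx orbT.
by rewrite ge_max !le_max r12 lexx orbT.
Qed.

Lemma le_smallest_maximizer lam1 lam2 x : (0 < lam1)%R -> (lam1 <= lam2)%R ->
  (eps lam2 x <= eps lam1 x)%R.
Proof. by move=> *; exact: smallest_maximizer_mono. Qed.

Lemma emeasurable_smallest_maximizer lam : (0 < lam)%R ->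
  measurable_fun setT (fun x => (eps lam x)%:E).
Proof.
by move=> lam0; apply/measurable_EFinP; exact: measurable_smallest_maximizer.
Qed.

Lemma integrable_smallest_maximizer lam : (0 < lam)%R ->
  \int[P]_x (eps lam x)%:E < +oo ->
  P.-integrable setT (fun x => (eps lam x)%:E).
Proof.
move=> lam0 foo; apply/integrableP; split.
  exact: emeasurable_smallest_maximizer.
by under eq_integral do rewrite gee0_abs ?lee_fin ?smallest_maximizer_ge0//.
Qed.

(** The limit of smallest maximizers as the multiplier decreases to lam. It can
    be +oo only for lam = 0, and then on a null set since its expectation is at
    most 1; elsewhere the closed graph applies. *)
Lemma exists_right_limit lam : (0 <= lam)%R ->
  (forall mu : R, (lam < mu)%R -> \int[P]_x (eps mu x)%:E <= 1) ->
  exists2 L : X -> \bar R, valid_evalue P L &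
    {ae P, forall x, exists2 z : R, amax (f x) lam z & L x = z%:E}.
Proof.
move=> lam0 int_le1; pose mu n := (lam + n.+1%:R^-1)%R.
have lam_mu n : (lam < mu n)%R by rewrite ltrDl invr_gt0.
have mu0 n : (0 < mu n)%R by exact: le_lt_trans (lam_mu n).
have mu_mono m n : (m <= n)%N -> (mu n <= mu m)%R.
  by move=> mn; rewrite lerD2l lef_pV2 ?posrE// ler_nat.
have mu_cvg : mu @ \oo --> lam.
  rewrite -[X in _ --> X]addr0; apply: cvgD; first exact: cvg_cst.
  exact: cvg_harmonic.
pose u n x := (eps (mu n) x)%:E.
have mu_u n : measurable_fun setT (u n) by exact: emeasurable_smallest_maximizer.
have u0 n x : 0 <= u n x by rewrite lee_fin smallest_maximizer_ge0.
have u_nd x : nondecreasing_seq (u ^~ x).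
  by move=> m n mn; rewrite lee_fin le_smallest_maximizer// mu_mono.
have u_cvg x : cvgn (u ^~ x) by exact: ereal_nondecreasing_is_cvgn.
pose L x := limn (u ^~ x).
have L0 x : 0 <= L x by apply: lime_ge => //; exact: nearW.
have mL : measurable_fun setT L.
  by apply: (emeasurable_fun_cvg u) => // x _; exact: u_cvg.
have intL : \int[P]_x L x <= 1.
  rewrite monotone_convergence//.
  apply: lime_le; last by apply: nearW => n; exact: int_le1.
  apply: ereal_nondecreasing_is_cvgn => m n mn.
  by apply: ge0_le_integral => // x _; exact: u_nd.
have iL : P.-integrable setT L.
  apply/integrableP; split=> //; under eq_integral do rewrite gee0_abs//.
  by rewrite (le_lt_trans intL)// ltry.
exists L; first by split.
have := integrable_ae measurableT iL; apply: filterS => x /(_ I) Lfin.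
exists (fine (L x)); last by rewrite fineK.
apply: (@argmax_closed_graph _ \oo _ mu (fun n => eps (mu n) x)
  _ _ _ (f_ge0 x) mu_cvg).
  have uL : u ^~ x @ \oo --> (fine (L x))%:E by rewrite fineK//; exact: u_cvg.
  exact: fine_cvg uL.
by apply: nearW => n; exact: smallest_maximizer_argmax.
Qed.

(** The limit of smallest maximizers as the multiplier increases to lam > 0; the
    first term of the sequence dominates the others. *)
Lemma exists_left_limit lam : (0 < lam)%R ->
  (forall mu : R, (0 < mu)%R -> \int[P]_x (eps mu x)%:E < +oo) ->
  (forall mu : R, (0 < mu)%R -> (mu < lam)%R -> 1 <= \int[P]_x (eps mu x)%:E) ->
  exists h : X -> R, [/\ measurable_fun setT h,
    forall x, amax (f x) lam (h x), 1 <= \int[P]_x (h x)%:E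
    & \int[P]_x (h x)%:E < +oo].
Proof.
move=> lam0 int_fin int_ge1.
(* The factor 1/2 keeps the first multiplier positive. *)
pose w n : R := (n.+1%:R^-1 / 2)%R; pose mu n := (lam * (1 - w n))%R.
have w0 n : (0 < w n)%R by rewrite divr_gt0 ?invr_gt0.
have w1 n : (w n < 1)%R.
  by rewrite ltr_pdivrMr// mul1r (le_lt_trans (_ : _ <= 1)%R)
    ?invf_le1 ?ltr1n// ler1n.
have mu0 n : (0 < mu n)%R by rewrite mulr_gt0// subr_gt0.
have mu_lam n : (mu n < lam)%R.
  by rewrite -[ltRHS]mulr1 ltr_pM2l// gtrBl.
have mu_mono m n : (m <= n)%N -> (mu m <= mu n)%R.
  move=> mn; rewrite ler_pM2l// lerD2l lerN2 ler_pM2r ?invr_gt0//.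
  by rewrite lef_pV2 ?posrE// ler_nat.
have mu_cvg : mu @ \oo --> lam.
  rewrite -[X in _ --> X]mulr1; apply: cvgM; first exact: cvg_cst.
  rewrite -[X in _ --> X]subr0; apply: cvgB; first exact: cvg_cst.
  rewrite -[X in _ --> X](mul0r 2^-1%R).
  by apply: cvgM; last exact: cvg_cst; exact: cvg_harmonic.
pose v n x := eps (mu n) x.
have v_ni x : nonincreasing_seq (v ^~ x).
  by move=> m n mn; apply: le_smallest_maximizer => //; exact: mu_mono.
have v_cvg x : cvgn (v ^~ x).
  apply: nonincreasing_is_cvgn => //.
  exists 0%R => _ [n _ <-]; exact: smallest_maximizer_ge0.
pose h x := limn (v ^~ x).
have mh : measurable_fun setT h.
  apply: (@measurable_fun_cvg _ _ _ _ v); last by move=> x _; exact: v_cvg.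
  by move=> n; exact: measurable_smallest_maximizer.
have [ih _ hcvg] : [/\ P.-integrable setT (EFin \o h),
    [sequence \int[P]_x `|(v n x)%:E - (h x)%:E|]_n @ \oo --> 0 &
    [sequence \int[P]_x (v n x)%:E]_n @ \oo --> \int[P]_x (h x)%:E].
  apply: (@dominated_convergence _ _ _ P setT measurableT
    (fun n x => (v n x)%:E) (EFin \o h) (fun x => (v 0%N x)%:E)).
  - by move=> n; exact: emeasurable_smallest_maximizer.
  - exact/measurable_EFinP.
  - by apply/aeW => x _; apply: cvg_EFin; [exact: nearW|exact: v_cvg].
  - by apply: integrable_smallest_maximizer => //; exact: int_fin.
  - apply/aeW => x n _; rewrite gee0_abs lee_fin ?smallest_maximizer_ge0//.
    exact: v_ni.
have hmax x : amax (f x) lam (h x).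
  apply: (@argmax_closed_graph _ \oo _ mu (v ^~ x) _ _ _ (f_ge0 x) mu_cvg).
    exact: v_cvg.
  by apply: nearW => n; exact: smallest_maximizer_argmax.
have h0 x : (0 <= h x)%R by exact: argmax_ge0 (hmax x).
exists h; split=> //.
- rewrite -(cvg_lim _ hcvg)//; apply: lime_ge.
    by apply/cvg_ex; eexists; exact: hcvg.
  by apply: nearW => n; exact: int_ge1.
- move/integrableP : ih => [_]; apply: le_lt_trans.
  by under [leRHS]eq_integral do rewrite gee0_abs ?lee_fin ?h0//.
Qed.

(** Dominated convergence along the multipliers n.+1, by [smallest_maximizer_cvg0]. *)
Lemma exists_integral_le1 :
  (forall mu : R, (0 < mu)%R -> \int[P]_x (eps mu x)%:E < +oo) ->
  exists2 mu : R, (0 < mu)%R & \int[P]_x (eps mu x)%:E <= 1.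
Proof.
move=> int_fin; apply: contrapT => no_mu.
have gt1 n : 1 <= \int[P]_x (eps n.+1%:R x)%:E.
  by rewrite leNgt; apply/negP => /ltW le1; apply: no_mu; exists n.+1%:R.
have natoo : n.+1%:R @[n --> \oo] --> (+oo%R : set_system R).
  apply/cvgryPge => A; near=> n.
  by rewrite (@le_trans _ _ n%:R%R) ?ler_nat//; near: n; exact: nbhs_infty_ger.
have [_ _ cvg0] : [/\ P.-integrable setT (cst 0),
    [sequence \int[P]_x `|(eps n.+1%:R x)%:E - cst 0 x|]_n @ \oo --> 0 &
    [sequence \int[P]_x (eps n.+1%:R x)%:E]_n @ \oo --> \int[P]_x cst 0 x].
  apply: (@dominated_convergence _ _ _ P setT measurableT
    (fun n x => (eps n.+1%:R x)%:E) (cst 0) (fun x => (eps 1 x)%:E)).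
  - by move=> n; exact: emeasurable_smallest_maximizer.
  - exact: measurable_cst.
  - apply/aeW => x _; apply: cvg_EFin; first exact: nearW.
    exact: (cvg_comp _ _ natoo (smallest_maximizer_cvg0 (f_ge0 x))).
  - by apply: integrable_smallest_maximizer => //; exact: int_fin.
  - apply/aeW => x n _; rewrite gee0_abs lee_fin ?smallest_maximizer_ge0//.
    by rewrite le_smallest_maximizer// ler1n.
suff : (1 : \bar R) <= 0 by rewrite lee_fin ler10.
rewrite integral0 in cvg0; rewrite -[leRHS](cvg_lim _ cvg0)//.
by apply: lime_ge; [apply/cvg_ex; eexists; exact: cvg0|exact: nearW].
Unshelve. all: by end_near. Qed.

Lemma argmax_conv r lam x y (t : R) : (0 <= r)%R -> (0 <= lam)%R ->
  (0 <= t <= 1)%R -> amax r lam x -> amax r lam y ->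
  amax r lam ((1 - t) * x + t * y)%R.
Proof.
move=> r0 lam0 /andP[t0 t1] Ax Ay; have [xy|/ltW yx] := leP x y.
- by apply: (argmax_interval r0 lam0 Ax Ay); apply/andP; split; nra.
- by apply: (argmax_interval r0 lam0 Ay Ax); apply/andP; split; nra.
Qed.

Lemma exists_multiplier :
  (forall mu : R, (0 < mu)%R -> \int[P]_x (eps mu x)%:E < +oo) ->
  exists (lam : R) (e : X -> \bar R), [/\ (0 <= lam)%R, valid_evalue P e,
    {ae P, forall x, exists2 z : R, amax (f x) lam z & e x = z%:E}
  & lam%:E * (1 - \int[P]_x e x) = 0].
Proof.
move=> int_fin.
pose S := [set mu : R | (0 < mu)%R /\ \int[P]_x (eps mu x)%:E <= 1].
have S0 : S !=set0 by have [mu mu0 mu1] := exists_integral_le1 int_fin; exists mu.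
have Slb : lbound S 0%R by move=> mu [/ltW].
pose lam := inf S; have lam0 : (0 <= lam)%R by exact: lb_le_inf.
have above mu : (lam < mu)%R -> \int[P]_x (eps mu x)%:E <= 1.
  move=> /(inf_lt S0)[s [s0 s1] smu].
  apply: le_trans s1; apply: ge0_le_integral => //.
  - by move=> x _; rewrite lee_fin smallest_maximizer_ge0.
  - by apply: emeasurable_smallest_maximizer; exact: lt_trans smu.
  - exact: emeasurable_smallest_maximizer.
  - by move=> x _; rewrite lee_fin le_smallest_maximizer// ltW.
have below mu : (0 < mu)%R -> (mu < lam)%R -> 1 <= \int[P]_x (eps mu x)%:E.
  move=> mu0 mul; rewrite leNgt; apply/negP => /ltW mu1.
  by move: mul; rewrite ltNge => /negP; apply; apply: ge_inf; [exists 0%R|split].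
have [L [[mL L0] intL] Lmax] := exists_right_limit lam0 above.
move: (lam0); rewrite le_eqVlt => /predU1P[lamE|lam_gt0].
  by exists lam, L; split=> //; rewrite -lamE mul0e.
have [h [mh hmax int_ge1 int_lty]] := exists_left_limit lam_gt0 int_fin below.
have h0 x : (0 <= h x)%R by exact: argmax_ge0 (hmax x).
have [a aE a1] : exists2 a : R, \int[P]_x L x = a%:E & (a <= 1)%R.
  have : 0 <= \int[P]_x L x by exact: integral_ge0.
  by case: (\int[P]_x L x) intL => [a|//|//]; exists a.
have [b bE b1] : exists2 b : R, \int[P]_x (h x)%:E = b%:E & (1 <= b)%R.
  by case: (\int[P]_x (h x)%:E) int_ge1 int_lty => [b|//|//]; exists b.
have [t /andP[t0 t1] tE] : exists2 t : R, (0 <= t <= 1)%R &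
    ((1 - t) * a + t * b = 1)%R.
  have [ab|ab] := eqVneq a b.
    by exists 0%R; rewrite ?lexx ?ler01//; lra.
  have {}ab : (0 < b - a)%R by rewrite subr_gt0 lt_neqAle ab (le_trans a1).
  exists ((1 - a) / (b - a))%R; last by field; rewrite gt_eqF.
  by rewrite divr_ge0 ?ler_pdivrMr//; lra.
pose e x := (1 - t)%:E * L x + t%:E * (h x)%:E.
have t1' : (0 <= 1 - t)%R by rewrite subr_ge0.
have mL' : measurable_fun setT (fun x => (1 - t)%:E * L x).
  by exact: measurable_funeM.
have mh' : measurable_fun setT (fun x => t%:E * (h x)%:E).
  by apply: measurable_funeM; exact/measurable_EFinP.
have inte : \int[P]_x e x = 1.
  rewrite ge0_integralD//; last 2 first.
  - by move=> x _; rewrite mule_ge0.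
  - by move=> x _; rewrite mule_ge0// lee_fin.
  rewrite !ge0_integralZl//; last 2 first.
  - exact/measurable_EFinP.
  - by move=> x _; rewrite lee_fin.
  by rewrite aE bE -!EFinM -EFinD tE.
exists lam, e; split=> //.
- split; last by rewrite inte.
  split; first exact: emeasurable_funD.
  by move=> x; rewrite adde_ge0// mule_ge0// lee_fin.
- apply: filterS Lmax => x [z zmax Lz].
  exists ((1 - t) * z + t * h x)%R; last by rewrite /e Lz -!EFinM -EFinD.
  by apply: argmax_conv => //; rewrite t0.
- by rewrite inte subee// mule0.
Qed.

(** * Optimality *)

Section optimality.
Hypothesis U_meas : measurable_fun `[0, +oo] U.
Context (Qa : {measure set X -> \bar R}).
Hypothesis Qa_f : Radon_Nikodym_version Qa P f.
Hypothesis Qa_fin : Qa setT < +oo.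

Lemma measurable_utility (e : X -> \bar R) :
  evalue e -> measurable_fun setT (U \o e).
Proof.
move=> [me e0]; apply: measurable_comp U_meas me; first exact: emeasurable_itv.
by move=> _ [x _ <-]; rewrite /= in_itv/= e0 leey.
Qed.

(** Only points with f x > 0 matter, and there a maximizer does at least as well as
    z = 1, where U is finite. *)
Lemma argmax_utility_fin_num lam (e : X -> \bar R) :
  {ae P, forall x, exists2 z : R, amax (f x) lam z & e x = z%:E} ->
  {ae Qa, forall x, U (e x) \is a fin_num}.
Proof.
move=> /(ae_null_dominates (density_dominates Qa_f)) emax.
apply: filterS2 emax (density_gt0 Qa_f) => x [z zmax ->] fx0.
by have [v ->] := argmax_real fx0 zmax.
Qed.

(** The inequality between the objectives at y and z, rearranged so that every term
    is nonnegative. If r > 0 and U y = -oo, the right-hand side is +oo. *)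
Lemma weighted_gain_ge lam r z y : (0 <= r)%R -> (0 <= lam)%R ->
  amax r lam z -> (0 <= y)%R ->
  maxe (- (U z%:E - U y%:E)) 0 * r%:E + lam%:E * z%:E <=
  maxe (U z%:E - U y%:E) 0 * r%:E + lam%:E * y%:E.
Proof.
move=> r0 lam0 Az y0; have [z0 zmax] := (argmaxP _ _ _).1 Az.
have := zmax _ y0; move: r0; rewrite le_eqVlt => /predU1P[<-|r0].
  by rewrite !objective0 !mule0 !add0e lee_fin lerN2.
have [v Uz] := argmax_real r0 Az; rewrite (objective_real _ _ Uz).
move: (utility_lt_pinfty y0); rewrite /pointwise_objective Uz.
case: (U y%:E) => [w _|//|_ _]; last first.
  by rewrite /= maxye gt0_mulye ?lte_fin// addye// leey.
rewrite -!EFinM -!EFinB -EFinN -!EFin_max -!EFinM -!EFinD !lee_fin => opt.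
have [vw|wv] := leP v w.
  by rewrite max_l ?max_r; lra.
by rewrite max_r ?max_l; lra.
Qed.

(** Where the loss is positive there is no gain, so [weighted_gain_ge] bounds it. *)
Lemma weighted_loss_le lam r z y : (0 <= r)%R -> (0 <= lam)%R ->
  amax r lam z -> (0 <= y)%R ->
  maxe (- (U z%:E - U y%:E)) 0 * r%:E <= lam%:E * y%:E.
Proof.
move=> r0 lam0 Az y0; have := weighted_gain_ge r0 lam0 Az y0.
have z0 := argmax_ge0 Az.
move: (U z%:E - U y%:E) => D.
have lamz0 : 0 <= lam%:E * z%:E by rewrite mule_ge0.
have lamy0 : 0 <= lam%:E * y%:E by rewrite mule_ge0.
have [D0|D0] := leP 0 D.
  by rewrite (_ : maxe (- D) 0 = 0) ?mul0e//; apply/max_idPr; rewrite oppe_le0.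
by rewrite mul0e add0e; apply: le_trans; rewrite leeDl.
Qed.

Lemma argmax_optimal lam (e : X -> \bar R) : (0 <= lam)%R ->
  valid_evalue P e ->
  {ae P, forall x, exists2 z : R, amax (f x) lam z & e x = z%:E} ->
  lam%:E * (1 - \int[P]_x e x) = 0 ->
  U_optimal P Qa U e.
Proof.
move=> lam0 ve emax slack; split=> // e' ve'.
have [[me e0] inte] := ve; have [[me' e'0] inte'] := ve'.
have Ufin := argmax_utility_fin_num emax.
have e'fin : {ae P, forall x, e' x \is a fin_num}.
  have /(integrable_ae measurableT) : P.-integrable setT e'.
    apply/integrableP; split=> //; under eq_integral do rewrite gee0_abs//.
    by rewrite (le_lt_trans inte')// ltry.
  by apply: filterS => x; exact.
pose D x := U (e x) - U (e' x).
have mD : measurable_fun setT D.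
  by apply: emeasurable_funB; apply: measurable_utility.
have mDp := measurable_funepos mD; have mDn := measurable_funeneg mD.
have mF : measurable_fun setT (EFin \o f) by exact/measurable_EFinP.
have F0 x : 0 <= (f x)%:E by rewrite lee_fin.
have le_int : \int[Qa]_x D^\- x + lam%:E * \int[P]_x e x <=
    \int[Qa]_x D^\+ x + lam%:E * \int[P]_x e' x.
  rewrite !(integral_density Qa_f)// -!ge0_integralZl//.
  rewrite -!ge0_integralD//; last 8 first.
  - by move=> x _; rewrite mule_ge0.
  - exact: emeasurable_funM.
  - by move=> x _; rewrite mule_ge0.
  - exact: measurable_funeM.
  - by move=> x _; rewrite mule_ge0.
  - exact: emeasurable_funM.
  - by move=> x _; rewrite mule_ge0.
  - exact: measurable_funeM.
  apply: ae_ge0_le_integral => //.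
  - by move=> x _; rewrite adde_ge0// mule_ge0.
  - by apply: emeasurable_funD; [exact: emeasurable_funM|exact: measurable_funeM].
  - by move=> x _; rewrite adde_ge0// mule_ge0.
  - by apply: emeasurable_funD; [exact: emeasurable_funM|exact: measurable_funeM].
  apply: filterS2 emax e'fin => x [z zmax ez] e'x _.
  move: (e'0 x); rewrite funeposE funenegE /D ez -(fineK e'x) => y0.
  exact: weighted_gain_ge.
have inte_fin : \int[P]_x e x \is a fin_num.
  by rewrite ge0_fin_numE ?integral_ge0// (le_lt_trans inte)// ltry.
have slackE : lam%:E * \int[P]_x e x = lam%:E.
  move: slack; rewrite -(fineK inte_fin) -EFinB -!EFinM => -[].
  by move=> slack; congr _%:E; move: slack; lra.
have lam_fin : lam%:E * \int[P]_x e' x <= lam%:E.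
  by rewrite -[leRHS]mule1 lee_wpmul2l// lee_fin.
have DnDp : \int[Qa]_x D^\- x <= \int[Qa]_x D^\+ x.
  rewrite -(@leeD2rE _ lam%:E)// -{1}slackE (le_trans le_int)//.
  by rewrite leeD2l.
have Dn_fin : \int[Qa]_x D^\- x < +oo.
  rewrite (@le_lt_trans _ _ (\int[P]_x (lam%:E * e' x)))//; last first.
    by rewrite ge0_integralZl// (le_lt_trans lam_fin)// ltry.
  rewrite (integral_density Qa_f)//; apply: ae_ge0_le_integral => //.
  - by move=> x _; rewrite mule_ge0.
  - exact: emeasurable_funM.
  - by move=> x _; rewrite mule_ge0.
  - exact: measurable_funeM.
  apply: filterS2 emax e'fin => x [z zmax ez] e'x _.
  move: (e'0 x); rewrite funenegE /D ez -(fineK e'x) => y0.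
  exact: weighted_loss_le.
split; last first.
  have Dn_fin_num : \int[Qa]_x D^\- x \is a fin_num.
    by rewrite ge0_fin_numE ?integral_ge0.
  by rewrite integralE sube_ge0 ?DnDp// Dn_fin_num.
split; last by right.
apply: filterS Ufin => x Ux; exact: fin_num_adde_defr.
Qed.

End optimality.
End evalues.
End utility.

Theorem theorem2 (d : measure_display) (X : measurableType d) (R : realType)
  (P Q : probability X R) (Qa Qs : {measure set X -> \bar R})
  (hQ : lebesgue_decomposition Q P Qa Qs)
  (f : X -> R) (hf : Radon_Nikodym_version Qa P f)
  (U : \bar R -> \bar R)
  (U_meas : measurable_fun `[0, +oo] U)
  (U_concave : concave_on `[0%R, +oo[ (fun z : R => U z%:E))
  (U_usc : upper_semicontinuous_on `[0%R, +oo[ (fun z : R => U z%:E))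
  (U_fin : forall z : R, (0 < z)%R -> U z%:E \is a fin_num)
  (U_limsup :
    limf_esup (fun z : R => U z%:E * (z^-1)%:E) (pinfty_nbhs R) <= 0) :
  [/\ forall (lam : R) (x : X), (0 < lam)%R ->
        [/\ pointwise_argmax U (f x) lam !=set0,
            compact (pointwise_argmax U (f x) lam),
            is_interval (pointwise_argmax U (f x) lam),
            pointwise_argmax U (f x) lam (smallest_maximizer U (f x) lam)
          & lbound (pointwise_argmax U (f x) lam)
              (smallest_maximizer U (f x) lam)],
      forall lam : R, (0 < lam)%R ->
        measurable_fun setT (fun x : X => smallest_maximizer U (f x) lam),
      forall (x : X) (lam1 lam2 : R), (0 < lam1)%R -> (lam1 <= lam2)%R ->
        (smallest_maximizer U (f x) lam2 <= smallest_maximizer U (f x) lam1)%R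
    & (forall lam : R, (0 < lam)%R ->
         \int[P]_x (smallest_maximizer U (f x) lam)%:E < +oo) ->
      (exists (lamstar : R) (estar : X -> \bar R),
        [/\ (0 <= lamstar)%R,
            valid_evalue P estar,
            {ae P, forall x, exists2 z : R,
               pointwise_argmax U (f x) lamstar z & estar x = z%:E},
            lamstar%:E * (1 - \int[P]_x estar x) = 0
          & {ae Qa, forall x, U (estar x) \is a fin_num}]) /\
      (exists e : X -> \bar R, U_optimal P Qa U e)].
Proof.
have [_ f0 _] := hf; have [mf _ _] := hf.
have Qa_fin : Qa setT < +oo.
  have [QE _ _] := hQ; have := probability_setT Q; rewrite QE// => Q1.
  by rewrite (le_lt_trans (leeDl _ (measure_ge0 Qs setT)))// Q1 ltry.
split.
- move=> lam x lam0; split.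
  + exact: argmax_nonempty.
  + exact: argmax_compact.
  + by apply: argmax_interval => //; exact: ltW.
  + exact: smallest_maximizer_argmax.
  + exact: smallest_maximizer_lbound.
- by move=> lam lam0; exact: measurable_smallest_maximizer.
- by move=> x lam1 lam2 lam10 lam12; exact: smallest_maximizer_mono.
move=> int_fin.
have [lam [e [lam0 ve emax slack]]] :=
  exists_multiplier U_concave U_usc U_fin U_limsup mf f0 int_fin.
split; last by exists e; exact: argmax_optimal ve emax slack.
by exists lam, e; split=> //; exact: argmax_utility_fin_num emax.
Qed.
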